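(* Let $\{\alpha_n\}_{n\ge0}$ be periodic and not identically $0$. Then $z_0\in\mathbb C$ is a limit of zeros of $\varphi_n(z)$ (i.e., there exist $z_n$ with $\varphi_n(z_n)=0$ and $z_n\to z_0$) if and only if $z_0$ lies in the support of $d\mu$.
   Context: $\{\alpha_n\}_{n\ge0}$ are complex numbers with $|\alpha_n|<1$ and $\alpha_{n+p}=\alpha_n$ for some $p\ge1$ and all $n$; $\rho_n=(1-|\alpha_n|^2)^{1/2}$. The orthonormal polynomials on the unit circle are defined by $\varphi_0\equiv1$, $\varphi_{n+1}(z)=\rho_n^{-1}(z\varphi_n(z)-\bar\alpha_n\varphi_n^*(z))$, where $\varphi_n^*(z)=z^n\overline{\varphi_n(1/\bar z)}$. $d\mu$ is the unique probability measure on the unit circle $\partial\mathbb D$ with Verblunsky coefficients $\{\alpha_n\}$, i.e. for which $\{\varphi_n\}_{n\ge0}$ are orthonormal. *)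

(* Defs.v *)
From HB Require Import structures.
From mathcomp Require Import all_boot all_order all_algebra.
From mathcomp Require Import complex.
From mathcomp Require Import all_classical all_reals all_analysis.

Set Implicit Arguments.
Unset Strict Implicit.
Unset Printing Implicit Defensive.

Import Order.TTheory GRing.Theory Num.Theory.
Import numFieldNormedType.Exports.

Local Open Scope classical_set_scope.
Local Open Scope ring_scope.

(* The usual metric topology of the complex plane, given by the norm of R[i]. *)
HB.instance Definition _ (R : realType) := NormedModule.copy R[i] R[i]^o.

Section OrthogonalPolynomials.
Context {R : realType}.
Implicit Types (alpha : nat -> R[i]) (P : {poly R[i]}).

(* The polynomial P^*(z) = z^n conj (P (1 / conj z)), written so that it also
   makes sense at z = 0; see [revpE].  The index n is an argument because P^*
   depends on it and not only on P. *)
Definition revp (n : nat) P : {poly R[i]} := \poly_(k < n.+1) (P`_(n - k))^*.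

Lemma revpE n P z : (size P <= n.+1)%N -> z != 0 ->
  (revp n P).[z] = z ^+ n * (P.[(z^*)^-1])^*.
Proof.
move=> sP z0; rewrite horner_poly (horner_coef_wide _ sP) rmorph_sum mulr_sumr.
rewrite (reindex_inj rev_ord_inj); apply: eq_bigr => k _ /=.
have kn : (k <= n)%N by rewrite -ltnS.
rewrite subSS subKn// rmorphM rmorphXn fmorphV /= conjCK mulrCA.
congr (_ * _).
by rewrite exprVn -expfB_cond// (negPf z0).
Qed.

Definition rho alpha (n : nat) : R[i] := sqrtC (1 - `|alpha n| ^+ 2).

Fixpoint phi alpha (n : nat) : {poly R[i]} :=
  if n is m.+1 then
    (rho alpha m)^-1 *: ('X * phi alpha m - (alpha m)^* *: revp m (phi alpha m))
  else 1.

Lemma size_phi alpha n : (size (phi alpha n) <= n.+1)%N.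
Proof.
elim: n => [|n IHn] /=; first by rewrite size_poly1.
apply: (leq_trans (size_scale_leq _ _)).
apply: (leq_trans (size_polyD _ _)); rewrite geq_max size_polyN; apply/andP; split.
  by rewrite mulrC; apply: (leq_trans (size_polyMleq _ _)); rewrite size_polyX addn2.
apply: (leq_trans (size_scale_leq _ _)).
by apply: (leq_trans (size_poly _ _)).
Qed.

End OrthogonalPolynomials.

(* The complex plane with its Borel sigma-algebra. *)
Notation borelC R := (g_sigma_algebraType (@open R[i])).

Section MeasuresOnTheCircle.
Context {R : realType}.
Implicit Type mu : {measure set (borelC R) -> \bar R}.

Definition unit_circle : set (borelC R) := [set z : R[i] | `|z| = 1].

Definition cintegral mu (D : set (borelC R)) (f : R[i] -> R[i]) : R[i] :=
  Complex (\int[mu]_(z in D) complex.Re (f z))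
          (\int[mu]_(z in D) complex.Im (f z)).

(* The closed support, as a subset of the plane. *)
Definition supp mu : set R[i] :=
  [set z | forall U : set R[i], open U -> U z -> (0 < mu U)%E].

(* Probability measures on the circle are the probability measures on the plane
   that give the circle full mass. *)
Definition is_verblunsky_measure (alpha : nat -> R[i]) mu : Prop :=
  mu unit_circle = 1%E /\
  forall m n : nat,
    cintegral mu unit_circle
      (fun z => ((phi alpha m).[z])^* * (phi alpha n).[z]) = (m == n)%:R.

End MeasuresOnTheCircle.

(* Main.v *)
Require Import Defs.
From mathcomp Require Import all_boot all_order all_algebra.
From mathcomp Require Import complex ring lra.
From mathcomp Require Import all_classical all_reals all_analysis.
From mathcomp Require Import measurable_realfun.
Import Order.TTheory GRing.Theory Num.Theory.
Import numFieldNormedType.Exports.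
Local Open Scope classical_set_scope.
Local Open Scope ring_scope.

(** Let K_n(z,s) be the sum of phi_j(z) conj(phi_j(s)) over j < n, which is the
    reproducing kernel of the polynomials of degree < n in L^2(mu).  By the
    Christoffel-Darboux formula [christoffel_darboux],
      (1 - z conj(s)) K_n(z,s)
        = phi_n^*(z) conj(phi_n^*(s)) - phi_n(z) conj(phi_n(s)).

    Limits of zeros lie in the support [supp_of_limit].  Let w and w' be zeros of
    phi_n and phi_{n+1}, both at distance at least c from mu-almost every point of
    the circle.  In terms of phi_n, the formula for K_{n+1} has the right side
    phi_n^*(z) conj(phi_n^*(s)) - z conj(s) phi_n(z) conj(phi_n(s)), of which only
    the first term remains at s = w; taking L^2 norms,
    c^2 K_{n+1}(w,w) <= |phi_n^*(w)|^2.  Moreover phi_{n+1} = (z - w') q with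
    c ||q|| <= 1, so c^2 |phi_{n+1}(w)|^2 <= |w - w'|^2 K_{n+1}(w,w).  As
    phi_{n+1}(w) is - conj(alpha_n) phi_n^*(w) / rho_n, this gives
    |alpha_n| c^2 <= |w - w'| [consecutive_zeros].  If zeros converge to a point off
    the support, then w - w' tends to 0, while alpha_n is a fixed nonzero number
    for infinitely many n.

    Points of the support are limits of zeros [zeros_near_support].  Let z0 be in the
    support, so |z0| = 1, and suppose that for infinitely many n the polynomial
    phi_n has no zero in the disc of radius 2d about z0.  The Christoffel-Darboux
    formula, divided out one zero at a time, expresses K_n(z,z) through the zeros
    w of phi_n: with L_n(z) the sum of (1 - |w|^2)/|z - w|^2,
    K_n(z,z) = |phi_n(z)|^2 L_n(z) on the circle, and K_n(z,z) is at least the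
    right side inside it [kern_diag_circle, kern_diag_ge].  As |w - z0|
    is at least 2d, each term of L_n changes by a factor of at most 4 in the disc of
    radius d, and so does L_n [zsum_comparable].

    - If L_n(z0) stays bounded along infinitely many of these n, let a_j be the
      integral of |phi_j|^2 over the arc of radius d.  Integrating the formula for
      K_n yields a_0 + ... + a_{n-1} <= C a_n <= C for these n.  Then a_n >= a_0/C
      infinitely often in a bounded sum of nonnegative terms, so a_0, which is the
      mass of the arc, vanishes [ball_null].
    - If L_n(z0) tends to infinity, then phi_n / phi_n^* tends to 0 inside the disc
      near z0, along one residue class n = j mod p.  The determinant
      phi_{n+p} phi_n^* - phi_n phi_{n+p}^* is z^n times its value for n = 0, so it
      tends to 0 as well, and comparison with the p-step transfer matrix shows that
      the upper right entry of this matrix vanishes at z.  Being a polynomial that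
      vanishes at infinitely many z, this entry is 0, which forces every alpha_n to
      be 0 [alpha_eq0_of_concentration]. *)

Set Implicit Arguments.
Unset Strict Implicit.
Unset Printing Implicit Defensive.

Local Notation "x %:C" := (real_complex _ x) (format "x %:C") : ring_scope.
Local Notation Re := (@complex.Re _).
Local Notation Im := (@complex.Im _).

(** * Reversed polynomials *)
Section ReversedPolynomials.
Context {R : realType}.
Implicit Types (f g : {poly R[i]}) (c : R[i]) (n : nat).

Lemma coef_revp n f k :
  (revp n f)`_k = if (k <= n)%N then (f`_(n - k))^* else 0.
Proof. by rewrite coef_poly ltnS. Qed.

Lemma revpB n f g : revp n (f - g) = revp n f - revp n g.
Proof.
apply/polyP => k; rewrite coefB !coef_revp.
by case: ifP => _; rewrite ?subr0// coefB rmorphB.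
Qed.

Lemma revpZ n c f : revp n (c *: f) = c^* *: revp n f.
Proof.
apply/polyP => k; rewrite coefZ !coef_revp.
by case: ifP => _; rewrite ?mulr0// coefZ rmorphM.
Qed.

Lemma revpXM n f : revp n.+1 ('X * f) = revp n f.
Proof.
apply/polyP => k; rewrite !coef_revp coefXM subn_eq0.
have [kn|nk] := leqP k n; first by rewrite leqW// subSn.
by rewrite rmorph0 if_same.
Qed.

Lemma revpS n f : (size f <= n.+1)%N -> revp n.+1 f = 'X * revp n f.
Proof.
move=> sf; apply/polyP => -[|k]; rewrite coefXM !coef_revp /=.
  by rewrite subn0 nth_default// rmorph0.
by rewrite subSS ltnS.
Qed.

Lemma revpK n f : (size f <= n.+1)%N -> revp n (revp n f) = f.
Proof.
move=> sf; apply/polyP => k; rewrite !coef_revp leq_subr.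
case: leqP => kn; first by rewrite subKn// conjCK.
by rewrite nth_default// (leq_trans sf).
Qed.

Lemma size_revp n f : (size (revp n f) <= n.+1)%N.
Proof. exact: size_poly. Qed.

End ReversedPolynomials.

(** * The recursion and the Christoffel-Darboux formula *)
Section Recursion.
Context {R : realType}.
Variable alpha : nat -> R[i].
Hypothesis alpha_lt1 : forall n, `|alpha n| < 1.
Implicit Types (z s w : R[i]) (n : nat).

Definition phis n : {poly R[i]} := revp n (phi alpha n).

Lemma sub_sqr_alpha_gt0 n : 0 < 1 - `|alpha n| ^+ 2.
Proof. by rewrite subr_gt0 expr_lt1. Qed.

Lemma rho_gt0 n : 0 < rho alpha n.
Proof. by rewrite sqrtC_gt0 sub_sqr_alpha_gt0. Qed.

Lemma rho_neq0 n : rho alpha n != 0.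
Proof. by rewrite gt_eqF ?rho_gt0. Qed.

Lemma sqr_rho n : rho alpha n ^+ 2 = 1 - alpha n * (alpha n)^*.
Proof. by rewrite sqrtCK normCK. Qed.

Lemma conj_rho n : (rho alpha n)^* = rho alpha n.
Proof. by rewrite geC0_conj// ltW// rho_gt0. Qed.

Lemma phis0 : phis 0 = 1.
Proof. by apply/polyP => -[|k]; rewrite coef_revp/= coef1 ?rmorph1. Qed.

Lemma phisS n :
  phis n.+1 = (rho alpha n)^-1 *: (phis n - alpha n *: ('X * phi alpha n)).
Proof.
rewrite /phis /= revpZ fmorphV/= conj_rho revpB revpXM revpZ conjCK.
by rewrite (revpS (size_revp _ _)) revpK// size_phi.
Qed.

Lemma horner_phiS n z : (phi alpha n.+1).[z] =
  (rho alpha n)^-1 * (z * (phi alpha n).[z] - (alpha n)^* * (phis n).[z]).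
Proof. by rewrite /= -/(phis n) !hornerE. Qed.

Lemma horner_phisS n z : (phis n.+1).[z] =
  (rho alpha n)^-1 * ((phis n).[z] - alpha n * (z * (phi alpha n).[z])).
Proof. by rewrite phisS !hornerE. Qed.

Definition kern n z s : R[i] :=
  \sum_(j < n) (phi alpha j).[z] * ((phi alpha j).[s])^*.

Lemma kernS n z s :
  kern n.+1 z s = kern n z s + (phi alpha n).[z] * ((phi alpha n).[s])^*.
Proof. by rewrite /kern big_ord_recr. Qed.

(** The form v(z) conj(v(s)) - u(z) conj(u(s)) is preserved by the matrix with rows
    (1, - conj(alpha)), (- alpha, 1) up to the factor 1 - |alpha|^2, which the
    normalisation by rho cancels. *)
Lemma szego_step n z s :
  (phis n.+1).[z] * ((phis n.+1).[s])^*
    - (phi alpha n.+1).[z] * ((phi alpha n.+1).[s])^*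
  = (phis n).[z] * ((phis n).[s])^*
    - z * s^* * ((phi alpha n).[z] * ((phi alpha n).[s])^*).
Proof.
rewrite !horner_phiS !horner_phisS !rmorphM/= !rmorphB/= !rmorphM/= !fmorphV/=.
rewrite conj_rho conjCK; set r := rho _ _.
have r0 : r != 0 by exact: rho_neq0.
set A := phi alpha n; set B := phis n; set a := alpha n.
apply: (mulfI (expf_neq0 2 r0)).
have hr : r ^+ 2 = 1 - a * a^* by exact: sqr_rho.
transitivity ((1 - a * a^* ) * (B.[z] * (B.[s])^* - z * s^* * (A.[z] * (A.[s])^*))).
  by field.
by rewrite hr.
Qed.

(** Telescoping of [szego_step]: each step turns a factor 1 into z conj(s), and the
    new term of the kernel restores it. *)
Lemma christoffel_darboux n z s : (1 - z * s^*) * kern n z s =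
  (phis n).[z] * ((phis n).[s])^* - (phi alpha n).[z] * ((phi alpha n).[s])^*.
Proof.
elim: n => [|n IHn].
  by rewrite /kern big_ord0 phis0 /= !hornerE subrr.
by rewrite szego_step kernS mulrDr IHn; ring.
Qed.

Lemma christoffel_darbouxS n z s : (1 - z * s^*) * kern n.+1 z s =
  (phis n).[z] * ((phis n).[s])^*
    - z * s^* * ((phi alpha n).[z] * ((phi alpha n).[s])^*).
Proof. by rewrite christoffel_darboux szego_step. Qed.

Lemma kern_diag n z : kern n z z = \sum_(j < n) `|(phi alpha j).[z]| ^+ 2.
Proof. by apply: eq_bigr => j _; rewrite normCK. Qed.

Lemma kern_diag_ge1 n z : (0 < n)%N -> 1 <= kern n z z.
Proof.
case: n => // n _; rewrite kern_diag big_ord_recl /= hornerC normr1 expr1n.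
by rewrite lerDl sumr_ge0// => j _; rewrite exprn_ge0.
Qed.

Lemma sub_normsq n z : `|(phis n).[z]| ^+ 2 - `|(phi alpha n).[z]| ^+ 2 =
  (1 - `|z| ^+ 2) * kern n z z.
Proof. by rewrite !normCK christoffel_darboux. Qed.

Lemma kern_diag_ge0 n z : 0 <= kern n z z.
Proof. by rewrite kern_diag sumr_ge0// => j _; rewrite exprn_ge0. Qed.

Lemma norm_phi_le n z : `|z| <= 1 -> `|(phi alpha n).[z]| <= `|(phis n).[z]|.
Proof.
move=> z1; rewrite -(@ler_pXn2r _ 2)// ?nnegrE// -subr_ge0 sub_normsq.
by rewrite mulr_ge0 ?kern_diag_ge0// subr_ge0 expr_le1.
Qed.

Lemma norm_phis_circle n z : `|z| = 1 -> `|(phis n).[z]| = `|(phi alpha n).[z]|.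
Proof.
move=> z1; apply/eqP; rewrite -(@eqrXn2 _ 2)// -subr_eq0 sub_normsq z1.
by rewrite expr1n subrr mul0r.
Qed.

(** At a zero, [sub_normsq] equates a square with (1 - |w|^2) times a kernel which
    is at least 1. *)
Lemma phi_root_le1 n w : root (phi alpha n) w -> `|w| <= 1.
Proof.
case: n => [|n] /rootP; first by rewrite /= hornerC => /eqP; rewrite oner_eq0.
move=> wn; have := sub_normsq n.+1 w; rewrite wn normr0 expr0n subr0 => h.
have := exprn_ge0 2 (normr_ge0 (phis n.+1).[w]); rewrite h.
rewrite pmulr_lge0 ?subr_ge0 ?expr_le1//.
by rewrite (lt_le_trans ltr01)// kern_diag_ge1.
Qed.

(** Since the kernel is at least 1, the reversed polynomials are bounded away from 0
    at each point of the open disc, uniformly in n. *)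
Lemma phis_ge n z : `|z| <= 1 -> 1 - `|z| ^+ 2 <= `|(phis n).[z]| ^+ 2.
Proof.
move=> z1; case: n => [|n].
  by rewrite phis0 hornerC normr1 expr1n gerBl exprn_ge0.
have -> : `|(phis n.+1).[z]| ^+ 2 =
  (1 - `|z| ^+ 2) * kern n.+1 z z + `|(phi alpha n.+1).[z]| ^+ 2.
  by rewrite -sub_normsq subrK.
apply: (@le_trans _ _ ((1 - `|z| ^+ 2) * kern n.+1 z z)).
  by rewrite ler_peMr ?kern_diag_ge1// subr_ge0 expr_le1.
by rewrite lerDl exprn_ge0.
Qed.

Lemma phis_coef0 n : 0 < (phis n).[0].
Proof.
elim: n => [|n IHn]; first by rewrite phis0 hornerC.
by rewrite horner_phisS mul0r mulr0 subr0 mulr_gt0 ?invr_gt0 ?rho_gt0.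
Qed.

Lemma lead_phi n : (phi alpha n)`_n != 0.
Proof.
have := phis_coef0 n; rewrite horner_coef0 coef_revp subn0 /= => h.
by apply: contraTneq h => ->; rewrite rmorph0 ltxx.
Qed.

Lemma size_phiE n : size (phi alpha n) = n.+1.
Proof.
apply/eqP; rewrite eqn_leq size_phi /= ltnNge.
by apply/negP => h; have := lead_phi n; rewrite nth_default ?eqxx.
Qed.

End Recursion.

(** * The kernel in terms of the zeros *)
Lemma poly_eq0_roots (F : fieldType) (f : {poly F}) (u : nat -> F) :
  injective u -> (forall k, root f (u k)) -> f = 0.
Proof.
move=> u_inj fu; apply: contraTeq isT => f0.
have := @max_poly_roots _ f [seq u i | i <- iota 0 (size f)] f0.
rewrite map_inj_uniq// iota_uniq size_map size_iota ltnn; apply => //.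
by apply/allP => _ /mapP[k _ ->].
Qed.

Section Zeros.
Context {R : realType}.
Implicit Types (z s w : R[i]) (ws : seq R[i]).

Definition zpoly ws : {poly R[i]} := \prod_(w <- ws) ('X - w%:P).
Definition zpolys ws : {poly R[i]} := \prod_(w <- ws) (1 - w^* *: 'X).

Lemma revp_zpoly ws : revp (size ws) (zpoly ws) = zpolys ws.
Proof.
rewrite /zpoly /zpolys; elim: ws => [|w ws IHws].
  rewrite !big_nil; apply/polyP => -[|k]; rewrite coef_revp/= coef1//.
  by rewrite rmorph1.
rewrite !big_cons mulrBl mul_polyC /= revpB revpXM revpZ revpS ?IHws.
  by rewrite mulrBl mul1r scalerAl.
by rewrite size_prod_XsubC.
Qed.

(** The quotient of Q(z) conj(Q(s)) - P(z) conj(P(s)) by 1 - z conj(s), for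
    P = [zpoly ws] and Q = [zpolys ws].  It is computed one zero at a time, because
    for a single zero the quotient is the constant 1 - |w|^2. *)
Fixpoint zkern ws s : {poly R[i]} :=
  if ws is w :: ws' then
    ((1 - w * w^* ) * (zpolys ws').[s]^*) *: zpolys ws'
      + (s - w)^* *: (('X - w%:P) * zkern ws' s)
  else 0.

Lemma zkernE ws z s : (1 - z * s^* ) * (zkern ws s).[z] =
  (zpolys ws).[z] * (zpolys ws).[s]^* - (zpoly ws).[z] * (zpoly ws).[s]^*.
Proof.
elim: ws => [|w ws IHws] /=.
  by rewrite /zpoly /zpolys !big_nil !hornerE rmorph1 subrr.
rewrite /zpoly /zpolys !big_cons -/(zpoly ws) -/(zpolys ws).
rewrite !(hornerE, rmorphM, rmorphB, rmorph1)/=.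
set X := (zpolys ws).[z]; set X' := (zpolys ws).[s]^*.
set Y := (zpoly ws).[z]; set Y' := (zpoly ws).[s]^*.
have YE : Y * Y' = X * X' - (1 - z * s^*) * (zkern ws s).[z].
  by rewrite IHws -/X -/X' -/Y -/Y' opprB addrC subrK.
transitivity ((1 - w^* * z) * (1 - w * s^*) * (X * X')
    - (z - w) * (s^* - w^*) * (Y * Y')); last by rewrite conjCK; ring.
by rewrite YE; ring.
Qed.

Lemma horner_factor z w : (1 - w^* *: 'X).[z] = 1 - w^* * z.
Proof. by rewrite !hornerE. Qed.

Lemma sub_normsq_factor z w :
  `|1 - w^* * z| ^+ 2 = `|z - w| ^+ 2 + (1 - `|z| ^+ 2) * (1 - `|w| ^+ 2).
Proof. by rewrite !normCK !(rmorphB, rmorphM, rmorph1)/= conjCK; ring. Qed.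

(** For z on the circle, the sum of the Poisson kernels of the points w, which is the
    derivative of the argument of the Blaschke product [zpoly ws] / [zpolys ws]. *)
Definition zsum ws z : R[i] :=
  \sum_(w <- ws) (1 - `|w| ^+ 2) / `|z - w| ^+ 2.

Lemma zsum_term_ge0 z w : `|w| <= 1 -> 0 <= (1 - `|w| ^+ 2) / `|z - w| ^+ 2.
Proof. by move=> w1; rewrite divr_ge0 ?exprn_ge0// subr_ge0 expr_le1. Qed.

Lemma norm_zpoly_le ws z : `|z| <= 1 -> (forall w, w \in ws -> `|w| <= 1) ->
  `|(zpoly ws).[z]| <= `|(zpolys ws).[z]|.
Proof.
move=> z1 ws1; rewrite /zpoly /zpolys !horner_prod !normr_prod.
rewrite big_seq [leRHS]big_seq; apply: ler_prod => w wws.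
rewrite hornerXsubC horner_factor normr_ge0 -(@ler_pXn2r _ 2)// ?nnegrE//.
rewrite sub_normsq_factor.
by rewrite lerDl mulr_ge0// subr_ge0 expr_le1// ws1.
Qed.

Lemma norm_zpoly_circle ws z : `|z| = 1 ->
  `|(zpolys ws).[z]| = `|(zpoly ws).[z]|.
Proof.
move=> z1; rewrite /zpoly /zpolys !horner_prod !normr_prod.
apply: eq_bigr => w _; apply/eqP; rewrite -(@eqrXn2 _ 2)// !hornerE /=.
by rewrite sub_normsq_factor z1 expr1n subrr mul0r addr0.
Qed.

Lemma zkern_diag_cons w ws z : (zkern (w :: ws) z).[z] =
  (1 - `|w| ^+ 2) * `|(zpolys ws).[z]| ^+ 2 + `|z - w| ^+ 2 * (zkern ws z).[z].
Proof. by rewrite /= !normCK !hornerE !rmorphB/=; ring. Qed.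

Lemma normsq_zpoly_cons w ws z : z != w ->
  `|(zpoly (w :: ws)).[z]| ^+ 2 * zsum (w :: ws) z =
  (1 - `|w| ^+ 2) * `|(zpoly ws).[z]| ^+ 2
    + `|z - w| ^+ 2 * (`|(zpoly ws).[z]| ^+ 2 * zsum ws z).
Proof.
move=> zw; rewrite /zpoly /zsum !big_cons -/(zpoly ws) -/(zsum ws z).
have h : `|z - w| != 0 by rewrite normr_eq0 subr_eq0.
rewrite hornerM hornerXsubC normrM; field; exact: h.
Qed.

(** Along the recursion of [zkern], replace each [zpolys] by the smaller [zpoly];
    on the circle the two have the same modulus, whence the equality of
    [zkern_diag_circle]. *)
Lemma zkern_diag_ge ws z : `|z| <= 1 -> z \notin ws ->
    (forall w, w \in ws -> `|w| <= 1) ->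
  `|(zpoly ws).[z]| ^+ 2 * zsum ws z <= (zkern ws z).[z].
Proof.
move=> z1; elim: ws => [|w ws IHws].
  by rewrite /zsum big_nil /= mulr0 horner0.
rewrite inE negb_or => /andP[zw zws] ws1.
have ws1' v : v \in ws -> `|v| <= 1 by move=> vws; rewrite ws1// inE vws orbT.
rewrite normsq_zpoly_cons// zkern_diag_cons lerD//; last first.
  by rewrite ler_wpM2l ?exprn_ge0// IHws.
rewrite ler_wpM2l ?subr_ge0 ?expr_le1 ?ws1 ?mem_head//.
by rewrite lerXn2r ?nnegrE// norm_zpoly_le.
Qed.

Lemma zkern_diag_circle ws z : `|z| = 1 -> z \notin ws ->
  (zkern ws z).[z] = `|(zpoly ws).[z]| ^+ 2 * zsum ws z.
Proof.
move=> z1; elim: ws => [|w ws IHws].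
  by rewrite /zsum big_nil /= mulr0 horner0.
rewrite inE negb_or => /andP[zw zws].
by rewrite normsq_zpoly_cons// zkern_diag_cons IHws// norm_zpoly_circle.
Qed.

(** Harnack's inequality, which holds term by term for sums of this form. *)
Lemma zsum_le4 ws z z' : (forall w, w \in ws -> `|w| <= 1) ->
    z \notin ws -> (forall w, w \in ws -> `|z' - w| <= 2 * `|z - w|) ->
    z' \notin ws ->
  zsum ws z <= 4 * zsum ws z'.
Proof.
move=> ws1 zws hws zws'; rewrite /zsum mulr_sumr big_seq [leRHS]big_seq.
apply: ler_sum => w wws.
have zw : 0 < `|z - w|.
  by rewrite normr_gt0 subr_eq0; apply: contraNneq zws => ->.
have zw' : 0 < `|z' - w|.
  by rewrite normr_gt0 subr_eq0; apply: contraNneq zws' => ->.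
rewrite mulrCA ler_wpM2l ?subr_ge0 ?expr_le1 ?ws1//.
rewrite ler_pdivlMr ?exprn_gt0// mulrC ler_pdivrMr ?exprn_gt0//.
have -> : 4 * `|z - w| ^+ 2 = (2 * `|z - w|) ^+ 2 by ring.
by rewrite lerXn2r ?nnegrE ?mulr_ge0// hws.
Qed.

End Zeros.

Section ZerosOfPhi.
Context {R : realType}.
Variable alpha : nat -> R[i].
Hypothesis alpha_lt1 : forall n, `|alpha n| < 1.
Implicit Types (z s w : R[i]) (n : nat).

Definition zeros n : seq R[i] := projT1 (closed_field_poly_normal (phi alpha n)).

Lemma phi_zeros n : phi alpha n = (phi alpha n)`_n *: zpoly (zeros n).
Proof.
rewrite /zeros; case: closed_field_poly_normal => ws /= {1}->.
by rewrite /lead_coef (size_phiE alpha_lt1).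
Qed.

Lemma size_zeros n : size (zeros n) = n.
Proof.
have := size_phiE alpha_lt1 n.
rewrite {1}phi_zeros size_scale ?lead_phi// size_prod_XsubC.
by case.
Qed.

Lemma root_zeros n w : root (phi alpha n) w = (w \in zeros n).
Proof. by rewrite {1}phi_zeros rootZ ?lead_phi// root_prod_XsubC. Qed.

Lemma zeros_le1 n w : w \in zeros n -> `|w| <= 1.
Proof. by rewrite -root_zeros => /(phi_root_le1 alpha_lt1). Qed.

Lemma phis_zeros n : phis alpha n = ((phi alpha n)`_n)^* *: zpolys (zeros n).
Proof.
rewrite /phis {1}phi_zeros revpZ; congr (_ *: _).
by rewrite -[X in revp X _](size_zeros n) revp_zpoly.
Qed.

Lemma horner_phi_zeros n z :
  (phi alpha n).[z] = (phi alpha n)`_n * (zpoly (zeros n)).[z].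
Proof. by rewrite {1}phi_zeros hornerZ. Qed.

Lemma horner_phis_zeros n z :
  (phis alpha n).[z] = ((phi alpha n)`_n)^* * (zpolys (zeros n)).[z].
Proof. by rewrite phis_zeros hornerZ. Qed.

Definition kernp n s : {poly R[i]} :=
  \sum_(j < n) ((phi alpha j).[s])^* *: phi alpha j.

Lemma kernpE n z s : (kernp n s).[z] = kern alpha n z s.
Proof.
by rewrite horner_sum; apply: eq_bigr => j _; rewrite hornerZ mulrC.
Qed.

(** Both sides, multiplied by 1 - z conj(s), satisfy the Christoffel-Darboux
    formula; the factor is cancelled in the ring of polynomials, so the identity
    also holds at z = s on the circle, where the factor vanishes. *)
Lemma kernp_zeros n s : kernp n s =
  (`|(phi alpha n)`_n| ^+ 2) *: zkern (zeros n) s.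
Proof.
apply/eqP; rewrite -subr_eq0; apply/eqP.
have : (1 - s^* *: 'X) *
    (kernp n s - (`|(phi alpha n)`_n| ^+ 2) *: zkern (zeros n) s) = 0.
  apply: (@poly_eq0_roots _ _ (fun k : nat => k%:R)).
    by move=> i j /eqP; rewrite eqr_nat => /eqP.
  move=> k; apply/rootP; rewrite !hornerE kernpE mulrBr [s^* * _]mulrC.
  rewrite christoffel_darboux// mulrCA zkernE !horner_phi_zeros !horner_phis_zeros.
  by rewrite !rmorphM/= conjCK normCK; ring.
move=> /eqP; rewrite mulf_eq0 => /orP[/eqP e|/eqP//].
have := horner_factor 0 s; rewrite e horner0 mulr0 subr0.
by move/esym/eqP; rewrite oner_eq0.
Qed.

Lemma kern_diag_ge n z : `|z| <= 1 -> z \notin zeros n ->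
  `|(phi alpha n).[z]| ^+ 2 * zsum (zeros n) z <= kern alpha n z z.
Proof.
move=> z1 zn; rewrite -kernpE kernp_zeros horner_phi_zeros hornerZ.
rewrite normrM exprMn -mulrA.
by rewrite ler_wpM2l ?exprn_ge0// zkern_diag_ge//; exact: zeros_le1.
Qed.

Lemma kern_diag_circle n z : `|z| = 1 -> z \notin zeros n ->
  kern alpha n z z = `|(phi alpha n).[z]| ^+ 2 * zsum (zeros n) z.
Proof.
move=> z1 zn; rewrite -kernpE kernp_zeros horner_phi_zeros hornerZ.
rewrite normrM exprMn.
by rewrite zkern_diag_circle// mulrA.
Qed.

End ZerosOfPhi.

(** * Transfer matrices of a periodic recursion *)
Section Modulus.
Context {R : realType}.
Implicit Types (z w : R[i]).

(** The norm of R[i] takes its values in R[i], whose order is partial; this is its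
    real value. *)
Definition modc z : R := Normc.normc z.

Lemma modcE z : `|z| = (real_complex R (modc z)).
Proof. by []. Qed.

Lemma modc_ge0 z : 0 <= modc z.
Proof. by rewrite -ler0c -modcE. Qed.

End Modulus.

(** The passage to the limit for [trans01_bound], after division by |phi_n^*|^2:
    x is |z| and t is |phi_n / phi_n^*|. *)
Lemma eq0_small_bounds (R : realType) (b x c e : R) :
    0 <= b -> 0 <= x < 1 -> 0 <= e ->
    (forall M : R, exists n t,
       [/\ M <= n%:R, 0 <= t, t ^+ 2 * M <= 1 & b <= x ^+ n * c + e * t]) ->
  b = 0.
Proof.
move=> b0 /andP[x0 x1] e0 H; apply/eqP; rewrite eq_le b0 andbT leNgt.
apply/negP => bgt0.
have xc0 : (x ^+ n * c) @[n --> \oo] --> (0 : R).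
  rewrite -[X in _ --> X](mul0r c); apply: cvgM; last exact: cvg_cst.
  by apply: cvg_expr; rewrite ger0_norm.
have b2 : 0 < b / 2 by rewrite divr_gt0.
have /cvgrPdist_lt/(_ _ b2) [N _ hN] := xc0.
have [n [t [Mn t0 tM hb]]] := H (N%:R + (4 * e ^+ 2 / b ^+ 2 + 1)).
have e2b : 0 <= 4 * e ^+ 2 / b ^+ 2 by rewrite divr_ge0 ?mulr_ge0 ?exprn_ge0.
have Nn : (N <= n)%N.
  by rewrite -(ler_nat R); apply: le_trans Mn; rewrite lerDl addr_ge0.
have := hN n Nn; rewrite /= sub0r normrN => /ltr_normlW xcb.
suff : e * t <= b / 2 by lra.
have b20 := ltW b2.
rewrite -(@ler_pXn2r _ 2)// ?nnegrE ?mulr_ge0// exprMn expr_div_n.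
have Nn0 : 0 <= N%:R :> R by [].
have h : t ^+ 2 * (4 * e ^+ 2 / b ^+ 2) <= 1.
  apply: le_trans tM; rewrite ler_wpM2l ?exprn_ge0//; lra.
have b2n : b ^+ 2 != 0 by rewrite expf_neq0// gt_eqF.
rewrite ler_pdivlMr ?exprn_gt0//.
have -> : e ^+ 2 * t ^+ 2 * 2 ^+ 2 = t ^+ 2 * (4 * e ^+ 2 / b ^+ 2) * b ^+ 2.
  by field; rewrite gt_eqF.
by rewrite -[leRHS]mul1r ler_wpM2r ?exprn_ge0.
Qed.

Section StepLinear.
Variable (P : comNzRingType).
Implicit Types (r a x A B C D f g : P).

Lemma step_linear1 r a x A B C D f g :
  r * (x * (A * f + B * g) - a * (C * f + D * g)) =
  r * (x * A - a * C) * f + r * (x * B - a * D) * g.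
Proof. ring. Qed.

Lemma step_linear2 r a x A B C D f g :
  r * (C * f + D * g - a * (x * (A * f + B * g))) =
  r * (C - a * (x * A)) * f + r * (D - a * (x * B)) * g.
Proof. ring. Qed.

End StepLinear.

Section Transfer.
Context {R : realType}.
Variable alpha : nat -> R[i].
Hypothesis alpha_lt1 : forall n, `|alpha n| < 1.
Implicit Types (z w : R[i]) (n m : nat) (v : {poly R[i]} * {poly R[i]}).

Definition szego n v : {poly R[i]} * {poly R[i]} :=
  ((rho alpha n)^-1 *: ('X * v.1 - (alpha n)^* *: v.2),
   (rho alpha n)^-1 *: (v.2 - alpha n *: ('X * v.1))).

(** The images of (1, 0) and (0, 1) are the columns of the m-step transfer matrix
    that starts at index n; keeping them as pairs avoids the ring of matrices. *)
Fixpoint trans n m v : {poly R[i]} * {poly R[i]} :=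
  if m is m'.+1 then szego (n + m') (trans n m' v) else v.

Lemma transS n m v : trans n m.+1 v = szego (n + m) (trans n m v).
Proof. by []. Qed.

Lemma trans_phi n m :
  trans n m (phi alpha n, phis alpha n) = (phi alpha (n + m), phis alpha (n + m)).
Proof.
elim: m => [|m IHm]; first by rewrite addn0.
by rewrite transS IHm addnS phisS.
Qed.

Lemma szego_linear n (v v' : {poly R[i]} * {poly R[i]}) (f g : {poly R[i]}) :
  szego n (v.1 * f + v'.1 * g, v.2 * f + v'.2 * g) =
  ((szego n v).1 * f + (szego n v').1 * g,
   (szego n v).2 * f + (szego n v').2 * g).
Proof.
rewrite /szego; congr pair; rewrite [in LHS]/fst [in LHS]/snd -!mul_polyC.
  exact: step_linear1.
exact: step_linear2.
Qed.

Lemma trans_linear n m v : trans n m v =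
  ((trans n m (1, 0)).1 * v.1 + (trans n m (0, 1)).1 * v.2,
   (trans n m (1, 0)).2 * v.1 + (trans n m (0, 1)).2 * v.2).
Proof.
elim: m => [|m IHm].
  by rewrite /trans !mul1r !mul0r addr0 add0r -surjective_pairing.
by rewrite !transS {1}IHm szego_linear.
Qed.

(** The second component starts and stays positive at 0.  Hence if the first
    component vanishes after a step, the last coefficient is 0 (evaluate at 0), and
    then the first component already vanished before that step. *)
Lemma trans01_eq0 n m : (trans n m (0, 1)).1 = 0 ->
  forall i, (i < m)%N -> alpha (n + i) = 0.
Proof.
have pos k : 0 < (trans n k (0, 1)).2.[0].
  elim: k => [|k IHk]; first by rewrite hornerC.
  rewrite transS hornerZ hornerD hornerN hornerZ hornerM hornerX mul0r mulr0.
  by rewrite subr0 mulr_gt0 ?invr_gt0 ?rho_gt0.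
elim: m => // m IHm /eqP; rewrite transS scaler_eq0 invr_eq0.
rewrite (negPf (rho_neq0 _ _))// orFb => /eqP e.
have a0 : alpha (n + m) = 0.
  have := congr1 (horner^~ 0) e; rewrite hornerD hornerN hornerZ hornerM hornerX.
  rewrite horner0 mul0r sub0r => /eqP.
  by rewrite oppr_eq0 mulf_eq0 (gt_eqF (pos m)) orbF conjC_eq0 => /eqP.
move: e; rewrite a0 rmorph0 scale0r subr0 => /eqP.
rewrite mulf_eq0 polyX_eq0 orFb => /eqP /IHm h i.
by rewrite ltnS leq_eqVlt => /orP[/eqP->//|/h].
Qed.

Variable p : nat.
Hypothesis alpha_periodic : forall n, alpha (n + p)%N = alpha n.

Lemma alpha_modn n : alpha (n %% p)%N = alpha n.
Proof.
rewrite [in RHS](divn_eq n p) addnC; elim: (n %/ p)%N => [|k IHk].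
  by rewrite mul0n addn0.
by rewrite mulSnr addnA alpha_periodic.
Qed.

Lemma alpha_addmodn n m : alpha (n %% p + m)%N = alpha (n + m).
Proof. by rewrite -alpha_modn modnDml alpha_modn. Qed.

Lemma rho_addmodn n m : rho alpha (n %% p + m)%N = rho alpha (n + m).
Proof. by rewrite /rho alpha_addmodn. Qed.

Lemma trans_modn n m v : trans (n %% p)%N m v = trans n m v.
Proof.
elim: m => // m IHm; rewrite !transS IHm.
by rewrite /szego alpha_addmodn rho_addmodn.
Qed.

Definition wronsk n z :=
  (phi alpha (n + p)).[z] * (phis alpha n).[z]
    - (phi alpha n).[z] * (phis alpha (n + p)).[z].

(** Both columns undergo the same step, since alpha (n + p) = alpha n, and each step
    has determinant z. *)
Lemma wronskE n z : wronsk n z = z ^+ n * wronsk 0 z.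
Proof.
elim: n => [|n IHn]; first by rewrite expr0 mul1r.
rewrite exprS -mulrA -IHn /wronsk addSn !horner_phiS// !horner_phisS//.
have -> : rho alpha (n + p) = rho alpha n by rewrite /rho alpha_periodic.
rewrite alpha_periodic; set r := rho _ _; set a := alpha n.
have r0 : r != 0 by exact: rho_neq0.
have hr : r ^+ 2 = 1 - a * a^* by exact: sqr_rho.
apply: (mulfI (expf_neq0 2 r0)); rewrite [in RHS]hr.
by field.
Qed.

(** Substitute the transfer matrix into [wronsk] and solve for its upper right
    entry.  After division by |phi_n^*|^2 the right side is small as soon as |z| < 1,
    n is large and phi_n / phi_n^* is small. *)
Lemma trans01_bound n z : `|z| <= 1 ->
  `|(trans n p (0, 1)).1.[z]| * `|(phis alpha n).[z]| ^+ 2 <=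
    `|z| ^+ n * `|wronsk 0 z|
    + (`|(trans n p (0, 1)).2.[z] - (trans n p (1, 0)).1.[z]|
        + `|(trans n p (1, 0)).2.[z]|)
      * (`|(phi alpha n).[z]| * `|(phis alpha n).[z]|).
Proof.
move=> z1; set A := (trans n p (1, 0)).1; set C := (trans n p (1, 0)).2.
set B := (trans n p (0, 1)).1; set D := (trans n p (0, 1)).2.
have [eA eC] : (phi alpha (n + p)).[z] =
      A.[z] * (phi alpha n).[z] + B.[z] * (phis alpha n).[z] /\
    (phis alpha (n + p)).[z] =
      C.[z] * (phi alpha n).[z] + D.[z] * (phis alpha n).[z].
  have := trans_phi n p; rewrite trans_linear => -[<- <-].
  by rewrite !hornerD !hornerM.
set u := (phi alpha n).[z]; set v := (phis alpha n).[z].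
have -> : `|B.[z]| * `|v| ^+ 2 =
    `|z ^+ n * wronsk 0 z + (D.[z] - A.[z]) * (u * v) + C.[z] * (u * u)|.
  rewrite -wronskE /wronsk eA eC -/u -/v -normrX -normrM; congr `|_|.
  by ring.
rewrite (le_trans (ler_normD _ _))//.
rewrite (le_trans (lerD (ler_normD _ _) (lexx _)))//.
rewrite -addrA !normrM normrX lerD2l mulrDl lerD2l ler_wpM2l//.
by rewrite ler_wpM2l// norm_phi_le.
Qed.

End Transfer.

(** * Zero-free discs with large zero sums *)
Section Nearby.
Context {R : realType}.
Implicit Types (z w : R[i]).

Lemma near_dist (z0 z w d : R[i]) : `|z - z0| <= d -> 2 * d <= `|z0 - w| ->
  (`|z0 - w| <= 2 * `|z - w|) /\ (`|z - w| <= 2 * `|z0 - w|).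
Proof.
move=> zd dw.
have dw' : d <= `|z0 - w| / 2 by rewrite ler_pdivlMr// mulrC.
have h : `|z - z0| <= `|z0 - w| / 2 by exact: le_trans dw'.
have e : `|z0 - w| = `|z0 - w| / 2 + `|z0 - w| / 2 by rewrite -splitr.
split.
  have : `|z0 - w| <= `|z0 - w| / 2 + `|z - w|.
    by rewrite (le_trans (ler_distD z _ _))// lerD2r// distrC.
  by rewrite {1}e lerD2l ler_pdivrMr// mulrC.
rewrite (le_trans (ler_distD z0 _ _))// mulrDl mul1r lerD2r (le_trans h)//.
by rewrite ler_pdivrMr// ler_peMr// ler1n.
Qed.

Variable alpha : nat -> R[i].
Hypothesis alpha_lt1 : forall n, `|alpha n| < 1.

Lemma near_notin_zeros n (z0 z : R[i]) (d : R) : 0 < d ->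
    (forall w, w \in zeros alpha n -> 2 * d%:C <= `|z0 - w|) ->
    `|z - z0| <= d%:C -> z \notin zeros alpha n.
Proof.
move=> d0 hw zd; apply/negP => /hw h.
have d0' : 0 < d%:C by rewrite (ltcR 0 d).
have := le_trans h (_ : `|z0 - z| <= d%:C).
rewrite distrC => /(_ zd); rewrite -subr_ge0.
have -> : d%:C - 2 * d%:C = - d%:C by ring.
by rewrite oppr_ge0 => /(lt_le_trans d0'); rewrite ltxx.
Qed.

Lemma zsum_comparable n (z0 z : R[i]) (d : R) : 0 < d ->
    (forall w, w \in zeros alpha n -> 2 * d%:C <= `|z0 - w|) ->
    `|z - z0| <= d%:C ->
  zsum (zeros alpha n) z <= 4 * zsum (zeros alpha n) z0 /\
  zsum (zeros alpha n) z0 <= 4 * zsum (zeros alpha n) z.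
Proof.
move=> d0 hw zd.
have zn := near_notin_zeros d0 hw zd.
have z0n : z0 \notin zeros alpha n.
  by apply: (near_notin_zeros d0 hw); rewrite subrr normr0 ler0c ltW.
have zeros1 := zeros_le1 alpha_lt1 (n := n).
by split; apply: zsum_le4 => //w /hw dw; have [] := near_dist zd dw.
Qed.

Variable p : nat.
Hypothesis p_gt0 : (0 < p)%N.
Hypothesis alpha_periodic : forall n, alpha (n + p)%N = alpha n.

Section Concentration.
Variables (z0 : R[i]) (d : R) (j : nat).
Hypothesis z0_circle : `|z0| = 1.
Hypothesis d_gt0 : 0 < d.
Hypothesis d_le1 : d <= 1.
Hypothesis zeros_far : forall (N : nat) (M : R), exists n,
  [/\ (N <= n)%N, (n %% p)%N = j,
      forall w, w \in zeros alpha n -> 2 * d%:C <= `|z0 - w| &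
      M%:C <= zsum (zeros alpha n) z0].

(** A large [zsum] makes phi_n / phi_n^* small at z: by [sub_normsq] and
    [kern_diag_ge], |phi_n^*|^2 is at least |phi_n|^2 (1 - |z|^2) zsum(z). *)
Lemma trans01_root z : `|z| < 1 -> `|z - z0| <= d%:C ->
  root (trans alpha j p (0, 1)).1 z.
Proof.
move=> z1 zd; apply/rootP/eqP; rewrite -normr_eq0 modcE.
set x := modc z.
have x1 : x < 1 by rewrite -(ltcR x 1) -modcE.
have x0 : 0 <= x := modc_ge0 z.
have x2 : 0 < 1 - x ^+ 2 by rewrite subr_gt0 expr_lt1.
set c := modc (wronsk alpha p 0 z) / (1 - x ^+ 2).
set e := modc ((trans alpha j p (0, 1)).2.[z] - (trans alpha j p (1, 0)).1.[z])
  + modc (trans alpha j p (1, 0)).2.[z].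
apply/eqP; congr (_%:C).
apply: (@eq0_small_bounds _ _ x c e); rewrite ?modc_ge0 ?x0 ?addr_ge0 ?modc_ge0//.
move=> M.
(* eq0_small_bounds asks for an index n with M <= n. *)
have [N NM] : exists N : nat, M <= N%:R.
  by exists (Num.trunc M).+1; rewrite ltW// truncnS_gt.
(* The factor 4 is lost in moving from z0 to z. *)
have [n [Nn nj hw hL]] := zeros_far N (4 * `|M| / (1 - x ^+ 2)).
have [_ hz] := zsum_comparable d_gt0 hw zd.
have zn := near_notin_zeros d_gt0 hw zd.
set a := modc (phi alpha n).[z]; set s := modc (phis alpha n).[z].
have a0 : 0 <= a := modc_ge0 _.
have s0 : 0 <= s := modc_ge0 _.
have s2 : 1 - x ^+ 2 <= s ^+ 2.
  have := phis_ge alpha_lt1 n (ltW z1); rewrite !modcE -/x -/s.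
  by rewrite -!rmorphXn -(rmorph1 (real_complex R)) -rmorphB lecR.
have as2 : a ^+ 2 * `|M| <= s ^+ 2.
  have x2C : 1 - `|z| ^+ 2 = (1 - x ^+ 2)%:C.
    by rewrite rmorphB rmorph1 rmorphXn.
  have MK : (a ^+ 2 * `|M| / (1 - x ^+ 2))%:C <= kern alpha n z z.
    apply: le_trans (kern_diag_ge alpha_lt1 (ltW z1) zn).
    have -> : (a ^+ 2 * `|M| / (1 - x ^+ 2))%:C =
        `|(phi alpha n).[z]| ^+ 2 * (`|M| / (1 - x ^+ 2))%:C.
      by rewrite -mulrA rmorphM rmorphXn.
    rewrite ler_wpM2l ?exprn_ge0//.
    rewrite -(@ler_pM2l _ 4)// (le_trans _ hz)// (le_trans _ hL)//.
    by rewrite -mulrA [leRHS]rmorphM/= rmorph_nat.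
  have s2E : (s ^+ 2)%:C = (1 - x ^+ 2)%:C * kern alpha n z z + (a ^+ 2)%:C.
    by rewrite -x2C -sub_normsq// !rmorphXn subrK.
  rewrite -lecR s2E -[leLHS]addr0 lerD ?ler0c ?exprn_ge0//.
  have -> : a ^+ 2 * `|M| = (1 - x ^+ 2) * (a ^+ 2 * `|M| / (1 - x ^+ 2)).
    by field; rewrite gt_eqF.
  by rewrite rmorphM ler_wpM2l// ler0c ltW.
have sgt0 : 0 < s.
  rewrite lt_neqAle s0 andbT eq_sym; apply: contraTneq (lt_le_trans x2 s2) => ->.
  by rewrite expr0n ltxx.
exists n, (a / s); split.
- by rewrite (le_trans NM)// ler_nat.
- by rewrite divr_ge0.
- rewrite expr_div_n mulrAC ler_pdivrMr ?exprn_gt0// mul1r (le_trans _ as2)//.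
  by rewrite ler_wpM2l ?exprn_ge0// ler_norm.
have := trans01_bound alpha_lt1 alpha_periodic n (ltW z1).
rewrite -!(trans_modn alpha_periodic n) nj.
rewrite !modcE -!rmorphXn -!rmorphM -!rmorphD -rmorphM -rmorphD lecR.
rewrite -/x -/e -/a -/s => h.
rewrite -(@ler_pM2r _ (s ^+ 2)) ?exprn_gt0// (le_trans h)// [leRHS]mulrDl lerD//.
  rewrite -mulrA ler_wpM2l ?exprn_ge0// /c mulrAC ler_pdivlMr//.
  by rewrite ler_wpM2l ?modc_ge0.
have -> : e * (a * s) = e * (a / s) * s ^+ 2 by field; rewrite gt_eqF.
by [].
Qed.

(** The points z0 (1 - d / (k + 2)) are infinitely many roots of the upper right
    entry of the p-step transfer matrix. *)
Lemma alpha_eq0_of_concentration n : alpha n = 0.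
Proof.
pose r k : R := 1 - d / k.+2%:R.
have dk k : 0 < d / k.+2%:R < 1.
  by rewrite divr_gt0//= ltr_pdivrMr// mul1r (le_lt_trans d_le1)// ltr1n.
have r0 k : 0 < r k by rewrite subr_gt0; have /andP[] := dk k.
have r1 k : r k < 1 by rewrite gtrBl; have /andP[] := dk k.
have z00 : z0 != 0 by rewrite -normr_eq0 z0_circle oner_eq0.
have normC (y : R) : 0 <= y -> `|y%:C| = y%:C by move=> y0; rewrite ger0_norm ?ler0c.
have B0 : (trans alpha j p (0, 1)).1 = 0.
  apply: (@poly_eq0_roots _ _ (fun k => z0 * (r k)%:C)).
    move=> k l /(mulfI z00) /complexI /addrI /oppr_inj.
    move=> /(mulfI (lt0r_neq0 d_gt0)) /invr_inj /eqP.
    by rewrite eqr_nat => /eqP [].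
  move=> k; apply: trans01_root.
    by rewrite normrM z0_circle mul1r normC ?ltW// ltcR.
  have -> : z0 * (r k)%:C - z0 = - (z0 * (d / k.+2%:R)%:C).
    by rewrite /r rmorphB rmorph1; ring.
  rewrite normrN normrM z0_circle mul1r normC ?lecR.
    by rewrite ler_pdivrMr// ler_peMr ?ler1n// ltW.
  by have /andP[/ltW] := dk k.
have a0 := trans01_eq0 alpha_lt1 B0.
have jp : (j <= p)%N by have [k [_ <- _ _]] := zeros_far 0 0; rewrite ltnW ?ltn_pmod.
rewrite -(alpha_modn alpha_periodic) -(modnDr n p).
have -> : (n + p = j + (n + (p - j)))%N by rewrite addnCA subnKC.
by rewrite -modnDmr (alpha_modn alpha_periodic) a0 ?ltn_pmod.
Qed.

End Concentration.
End Nearby.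

(** * Borel functions on the circle *)
Section Borel.
Context {R : realType}.
Implicit Types (z w : R[i]) (U : set R[i]).

Lemma open_measurableC U : open U -> measurable (U : set (borelC R)).
Proof. by move=> oU; exact: sub_sigma_algebra. Qed.

Lemma norm_Re_le z : `|Re z| <= modc z.
Proof. by rewrite -lecR -modcE normc_ge_Re. Qed.

Lemma norm_Im_le z : `|Im z| <= modc z.
Proof.
case: z => a b; rewrite -sqrtr_sqr ler_sqrt ?addr_ge0 ?sqr_ge0//=.
by rewrite lerDr sqr_ge0.
Qed.

Lemma open_ballC (z0 : R[i]) (e : R[i]) : open [set z : R[i] | `|z0 - z| < e].
Proof. by exact: (@ball_open _ R[i]^o). Qed.

Lemma measurable_real_part (f : R[i] -> R) :
    (forall z w, `|f z - f w| <= modc (z - w)) ->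
  measurable_fun [set: borelC R] (f : borelC R -> R).
Proof.
move=> f_lip; apply: (measurability _ (RGenOInfty.measurableE R)).
move=> _ [_ [x ->]] <-; rewrite setTI; apply: open_measurableC.
rewrite openE => z /=; rewrite in_itv/= andbT => xz.
apply/nbhs_ballP; exists (f z - x)%:C; first by rewrite /= (ltcR 0) subr_gt0.
move=> w; rewrite -ball_normE /= in_itv/= andbT modcE ltcR => h.
have := le_lt_trans (le_trans (ler_norm _) (f_lip z w)) h.
by rewrite ltrD2l ltrN2.
Qed.

Lemma measurable_Re : measurable_fun [set: borelC R] (Re : borelC R -> R).
Proof.
apply: measurable_real_part => z w.
by have := norm_Re_le (z - w); case: z w => a b [c d].
Qed.

Lemma measurable_Im : measurable_fun [set: borelC R] (Im : borelC R -> R).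
Proof.
apply: measurable_real_part => z w.
by have := norm_Im_le (z - w); case: z w => a b [c d].
Qed.

Lemma measurable_circle : measurable (@unit_circle R).
Proof.
have -> : @unit_circle R = setT `&`
    (fun z : borelC R => Re z ^+ 2 + Im z ^+ 2) @^-1` [set 1].
  rewrite setTI; apply/seteqP; split => z /=.
    move=> z1; apply: complexI.
    by rewrite add_Re2_Im2 z1 expr1n.
  by rewrite /unit_circle/= normc_def => ->; rewrite sqrtr1.
apply: (_ : measurable_fun setT _) => //.
by apply: measurable_funD; apply: measurable_funX;
  [exact: measurable_Re|exact: measurable_Im].
Qed.

(** A class stable under the ring operations and conjugation, large enough to contain
    the integrands built from polynomials, and all of whose members are integrable
    on the circle. *)
Definition tame (f : R[i] -> R[i]) :=
  [/\ measurable_fun [set: borelC R] (Re \o f : borelC R -> R),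
      measurable_fun [set: borelC R] (Im \o f : borelC R -> R) &
      exists M : R, forall z, `|z| = 1 -> modc (f z) <= M].

Lemma modcM z w : modc (z * w) = modc z * modc w.
Proof. exact: Normc.normcM. Qed.

Lemma le_modcD z w : modc (z + w) <= modc z + modc w.
Proof. exact: le_normcD. Qed.

Lemma tame_cst c : tame (fun=> c).
Proof. by split; [exact: measurable_cst|exact: measurable_cst|exists (modc c)]. Qed.

Lemma tame_id : tame id.
Proof.
split; [exact: measurable_Re|exact: measurable_Im|exists 1 => z z1].
by rewrite -lecR -modcE z1.
Qed.

Lemma tameD f g : tame f -> tame g -> tame (fun z => f z + g z).
Proof.
move=> [mRf mIf [A Af]] [mRg mIg [B Bg]]; split.
- rewrite (_ : _ \o _ = (Re \o f) \+ (Re \o g)); first exact: measurable_funD.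
  by apply/funext => z /=; case: (f z) (g z) => [a b] [].
- rewrite (_ : _ \o _ = (Im \o f) \+ (Im \o g)); first exact: measurable_funD.
  by apply/funext => z /=; case: (f z) (g z) => [a b] [].
- exists (A + B) => z z1; rewrite (le_trans (le_modcD _ _))//.
  by rewrite lerD ?Af ?Bg.
Qed.

Lemma tameM f g : tame f -> tame g -> tame (fun z => f z * g z).
Proof.
move=> [mRf mIf [A Af]] [mRg mIg [B Bg]]; split.
- rewrite (_ : _ \o _ = ((Re \o f) \* (Re \o g)) \- ((Im \o f) \* (Im \o g))).
    by apply: measurable_funB; exact: measurable_funM.
  by apply/funext => z /=; case: (f z) (g z) => [a b] [].
- rewrite (_ : _ \o _ = ((Re \o f) \* (Im \o g)) \+ ((Im \o f) \* (Re \o g))).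
    by apply: measurable_funD; exact: measurable_funM.
  by apply/funext => z /=; case: (f z) (g z) => [a b] [].
- exists (A * B) => z z1; rewrite modcM.
  by rewrite ler_pM ?modc_ge0 ?Af ?Bg.
Qed.

Lemma tame_conj f : tame f -> tame (fun z => (f z)^*).
Proof.
move=> [mRf mIf [A Af]]; split.
- rewrite (_ : _ \o _ = (Re \o f))//.
  by apply/funext => z /=; case: (f z).
- rewrite (_ : _ \o _ = \- (Im \o f)); first exact: measurable_funN.
  by apply/funext => z /=; case: (f z).
- by exists A => z /Af; rewrite -lecR -modcE -norm_conjC modcE lecR.
Qed.

Lemma tame_horner (f : {poly R[i]}) : tame (fun z => f.[z]).
Proof.
elim/poly_ind: f => [|f c IHf].
  by under [fun=> _]funext do rewrite horner0; exact: tame_cst.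
under [fun=> _]funext do rewrite hornerMXaddC.
by apply: tameD; [apply: tameM => //; exact: tame_id|exact: tame_cst].
Qed.

End Borel.

(** * Integrals of complex functions *)
Section ComplexIntegral.
Context {R : realType}.
Variable mu : probability (borelC R) R.
Implicit Types (D : set (borelC R)) (f g : R[i] -> R[i]).

Lemma tame_integrable D f : measurable D -> D `<=` @unit_circle R -> tame f ->
  mu.-integrable D (EFin \o (Re \o f : borelC R -> R)) /\
  mu.-integrable D (EFin \o (Im \o f : borelC R -> R)).
Proof.
move=> mD DS [mR mI [M fM]].
have muD : (mu D < +oo)%E by rewrite (le_lt_trans (probability_le1 _ _)) ?ltry.
by split; (apply: measurable_bounded_integrable => //;
  [exact: (measurable_funS measurableT)|
   exists M; split; [exact: num_real|move=> x Mx z /DS z1 /=]]);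
  rewrite (le_trans _ (ltW Mx))// (le_trans _ (fM z z1))//;
  [exact: norm_Re_le|exact: norm_Im_le].
Qed.

Variable D : set (borelC R).
Hypotheses (mD : measurable D) (DS : D `<=` @unit_circle R).

Lemma cintegralD f g : tame f -> tame g ->
  cintegral mu D (fun z => f z + g z) = cintegral mu D f + cintegral mu D g.
Proof.
move=> /(tame_integrable mD DS)[fR fI] /(tame_integrable mD DS)[gR gI].
rewrite /cintegral [RHS]/GRing.add /=; congr Complex.
- rewrite -(RintegralD mD fR gR); apply: eq_Rintegral => z _ /=.
  by case: (f z) (g z) => [a b] [].
- rewrite -(RintegralD mD fI gI); apply: eq_Rintegral => z _ /=.
  by case: (f z) (g z) => [a b] [].
Qed.

Lemma integrableZ r (h : borelC R -> R) : mu.-integrable D (EFin \o h) ->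
  mu.-integrable D (EFin \o (fun z => r * h z)).
Proof. by move=> hi; exact: (integrableZl mD r hi). Qed.

Lemma cintegralZ c f : tame f ->
  cintegral mu D (fun z => c * f z) = c * cintegral mu D f.
Proof.
move=> /(tame_integrable mD DS)[fR fI]; case: c => a b.
rewrite /cintegral [RHS]/GRing.mul /=; congr Complex.
- rewrite -(RintegralZl a mD fR) -(RintegralZl b mD fI) -RintegralB//;
    try exact: integrableZ.
  by apply: eq_Rintegral => z _ /=; case: (f z).
- rewrite -(RintegralZl b mD fR) -(RintegralZl a mD fI) -RintegralD//;
    try exact: integrableZ.
  by apply: eq_Rintegral => z _ /=; case: (f z).
Qed.

Lemma cintegral_conj f : tame f ->
  cintegral mu D (fun z => (f z)^*) = (cintegral mu D f)^*.
Proof.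
move=> /(tame_integrable mD DS)[fR fI].
rewrite /cintegral [RHS]/=; congr Complex.
- by apply: eq_Rintegral => z _ /=; case: (f z).
- rewrite -mulN1r -(RintegralZl _ mD fI).
  by apply: eq_Rintegral => z _ /=; case: (f z) => a b /=; rewrite mulN1r.
Qed.

Lemma eq_cintegral f g : (forall z, D z -> f z = g z) ->
  cintegral mu D f = cintegral mu D g.
Proof.
by move=> fg; congr Complex; apply: eq_Rintegral => z /set_mem /fg /= ->.
Qed.

Lemma cintegral_ge0 f : (forall z, D z -> 0 <= f z) -> 0 <= cintegral mu D f.
Proof.
move=> f0; rewrite lecE /=; apply/andP; split.
  rewrite (@eq_Rintegral _ _ _ mu D (fun=> 0)).
    by rewrite Rintegral_cst// mul0r.
  by move=> z /set_mem /f0; rewrite lecE => /andP[/eqP].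
by apply: Rintegral_ge0 => z /f0; rewrite lecE => /andP[].
Qed.

Lemma le_cintegral f g : tame f -> tame g -> (forall z, D z -> f z <= g z) ->
  cintegral mu D f <= cintegral mu D g.
Proof.
move=> tf tg fg; rewrite -subr_ge0 -mulN1r -cintegralZ//.
rewrite -cintegralD//; last by apply: tameM => //; exact: tame_cst.
by apply: cintegral_ge0 => z /fg; rewrite mulN1r subr_ge0.
Qed.

Lemma cintegral_cst c : cintegral mu D (fun=> c) = c * (fine (mu D))%:C.
Proof.
case: c => a b; rewrite /cintegral [RHS]/GRing.mul/= !Rintegral_cst//.
by rewrite !mulr0 subr0 add0r.
Qed.

End ComplexIntegral.

Section Null.
Context {R : realType}.
Variable mu : probability (borelC R) R.
Implicit Types (D U : set (borelC R)) (f g : R[i] -> R[i]).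

Lemma cintegral_setD_null D U f : measurable D -> D `<=` @unit_circle R ->
    measurable U -> mu U = 0%E -> tame f ->
  cintegral mu D f = cintegral mu (D `\` U) f.
Proof.
move=> mD DS mU U0 /(tame_integrable mu mD DS)[fR fI].
by rewrite /cintegral /Rintegral; congr (Complex (fine _) (fine _));
  apply: negligible_integral.
Qed.

Lemma subset_le_cintegral D D' f :
    measurable D -> measurable D' -> D `<=` D' -> D' `<=` @unit_circle R ->
    tame f -> (forall z, 0 <= f z) ->
  cintegral mu D f <= cintegral mu D' f.
Proof.
move=> mD mD' DD' D'S tf f0.
have mDD : measurable (D' `\` D) by exact: measurableD.
have [fR fI] := tame_integrable mu mD' D'S tf.
have -> : cintegral mu D' f = cintegral mu D f + cintegral mu (D' `\` D) f.
  rewrite /cintegral [RHS]/GRing.add/= -!Rintegral_setU ?setDUK//;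
    by rewrite disj_set2E setDIK.
by rewrite lerDl cintegral_ge0.
Qed.

End Null.

(** * The inner product and the reproducing kernel *)
Section InnerProduct.
Context {R : realType}.
Variable mu : probability (borelC R) R.
Implicit Types (f g h : {poly R[i]}).
Local Notation S := (@unit_circle R).

Definition ip f g := cintegral mu S (fun z => (f.[z])^* * g.[z]).

Lemma tame_ip f g : tame (fun z => (f.[z])^* * g.[z]).
Proof. by apply: tameM; [apply: tame_conj|]; exact: tame_horner. Qed.

Lemma ipDr f g h : ip f (g + h) = ip f g + ip f h.
Proof.
rewrite -(cintegralD mu (@measurable_circle R))//; [|exact: tame_ip..].
by apply: eq_cintegral => z _; rewrite hornerD mulrDr.
Qed.

Lemma ipZr f c g : ip f (c *: g) = c * ip f g.
Proof.
rewrite -(cintegralZ mu (@measurable_circle R))//; [|exact: tame_ip..].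
by apply: eq_cintegral => z _; rewrite hornerZ mulrCA.
Qed.

Lemma ipC f g : (ip f g)^* = ip g f.
Proof.
rewrite -(cintegral_conj mu (@measurable_circle R))//; [|exact: tame_ip..].
by apply: eq_cintegral => z _; rewrite rmorphM/= conjCK mulrC.
Qed.

Lemma ipDl f g h : ip (g + h) f = ip g f + ip h f.
Proof. by rewrite -ipC ipDr rmorphD/= !ipC. Qed.

Lemma ipZl f c g : ip (c *: g) f = c^* * ip g f.
Proof. by rewrite -ipC ipZr rmorphM/= !ipC. Qed.

Lemma ip_suml I (r : seq I) (P : pred I) (F : I -> {poly R[i]}) f :
  ip (\sum_(i <- r | P i) F i) f = \sum_(i <- r | P i) ip (F i) f.
Proof.
elim/big_rec2: _ => [|i y x _ <-]; last by rewrite ipDl.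
by rewrite -[X in ip X](scale0r 0) ipZl rmorph0 mul0r.
Qed.

Lemma ip_ge0 f : 0 <= ip f f.
Proof.
apply: cintegral_ge0 => [|z _]; first exact: measurable_circle.
by rewrite mulrC mul_conjC_ge0.
Qed.

Lemma ip_ext f g : (forall z, `|z| = 1 -> `|f.[z]| = `|g.[z]|) -> ip f f = ip g g.
Proof.
by move=> fg; apply: eq_cintegral => z /fg zz; rewrite ![_^* * _]mulrC -!normCK zz.
Qed.

(** Multiplication by a function of modulus at least c almost everywhere increases
    the norm by a factor c; it serves for z - w with w away from the support. *)
Lemma ip_lower_bound (U : set R[i]) c f g : open U -> mu U = 0%E -> 0 <= c ->
  (forall z, `|z| = 1 -> ~ U z -> c * `|f.[z]| <= `|g.[z]|) ->
  c ^+ 2 * ip f f <= ip g g.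
Proof.
move=> oU U0 c0 fg; have mU := open_measurableC oU.
have mS := @measurable_circle R.
rewrite -(cintegralZ _ mS)//; last exact: tame_ip.
rewrite (cintegral_setD_null mS _ mU U0)//; last first.
  by apply: tameM; [exact: tame_cst|exact: tame_ip].
rewrite [leRHS](cintegral_setD_null mS _ mU U0)//; last exact: tame_ip.
apply: le_cintegral => [|z []//|||z [z1 nUz]].
- exact: measurableD.
- by apply: tameM; [exact: tame_cst|exact: tame_ip].
- exact: tame_ip.
- rewrite ![_^* * _]mulrC -!normCK -exprMn lerXn2r ?nnegrE ?mulr_ge0//.
  exact: fg.
Qed.

End InnerProduct.

Section Orthogonality.
Context {R : realType}.
Variable alpha : nat -> R[i].
Hypothesis alpha_lt1 : forall n, `|alpha n| < 1.
Variable mu : probability (borelC R) R.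
Hypothesis mu_alpha : is_verblunsky_measure alpha mu.
Implicit Types (f g : {poly R[i]}) (w : R[i]).

Lemma ip_phi m n : ip mu (phi alpha m) (phi alpha n) = (m == n)%:R.
Proof. exact: mu_alpha.2. Qed.

Lemma ip_kernp_phi n m w : (m < n)%N ->
  ip mu (kernp alpha n w) (phi alpha m) = (phi alpha m).[w].
Proof.
move=> mn; rewrite ip_suml (bigD1 (Ordinal mn))//= ipZl ip_phi eqxx mulr1 conjCK.
rewrite big1 ?addr0// => j jm; rewrite ipZl ip_phi.
by rewrite -val_eqE/= in jm; rewrite (negPf jm) mulr0.
Qed.

(** The kernel reproduces each phi_m with m < n, and these span the polynomials of
    degree less than n because phi_m has degree exactly m. *)
Lemma ip_kernp n f w : (size f <= n)%N -> ip mu (kernp alpha n w) f = f.[w].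
Proof.
suff : forall m, (m <= n)%N -> forall f, (size f <= m)%N ->
  ip mu (kernp alpha n w) f = f.[w] by move=> /(_ n); exact.
move=> {f}; elim=> [_ f|m IHm mn f sf].
  rewrite size_poly_leq0 => /eqP ->; rewrite horner0.
  by rewrite -(scale0r 0) ipZr mul0r.
have lm := lead_phi alpha_lt1 m.
pose c := f`_m / (phi alpha m)`_m; pose g := f - c *: phi alpha m.
have fE : f = g + c *: phi alpha m by rewrite /g subrK.
have sg : (size g <= m)%N.
  apply/leq_sizeP => k; rewrite leq_eqVlt => /orP[/eqP <-|mk].
    by rewrite coefB coefZ /c divfK ?subrr.
  rewrite coefB coefZ !nth_default ?mulr0 ?subrr//.
    by rewrite size_phiE.
  exact: leq_trans sf mk.
by rewrite fE ipDr ipZr IHm// ?ip_kernp_phi// ?hornerD ?hornerZ// ltnW.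
Qed.

Lemma size_kernp n w : (size (kernp alpha n w) <= n)%N.
Proof.
apply: (leq_trans (size_sum _ _ _)); apply/bigmax_leqP => j _.
by rewrite (leq_trans (size_scale_leq _ _))// (size_phiE alpha_lt1).
Qed.

Lemma ip_kernp_kernp n w :
  ip mu (kernp alpha n w) (kernp alpha n w) = kern alpha n w w.
Proof. by rewrite ip_kernp ?size_kernp// kernpE. Qed.

(** The Cauchy-Schwarz inequality for f(w) = <K_w, f>, from the positivity of the
    squared norm of K(w,w) f - f(w) K_w. *)
Lemma horner_le_kern n f w : (0 < n)%N -> (size f <= n)%N ->
  `|f.[w]| ^+ 2 <= ip mu f f * kern alpha n w w.
Proof.
move=> n0 sf; have K1 := kern_diag_ge1 alpha w n0.
have K0 : 0 < kern alpha n w w := lt_le_trans ltr01 K1.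
set K := kern alpha n w w in K0 *; set N := ip mu f f.
have := ip_ge0 mu (K *: f + (- f.[w]) *: kernp alpha n w).
rewrite !(ipDl, ipDr, ipZl, ipZr) -(ipC _ (kernp _ _ _) f) ip_kernp_kernp !ip_kernp//.
rewrite (geC0_conj (ltW K0)) -/K -/N; set u := f.[w].
have -> : (- u)^* = - u^* by rewrite rmorphN.
rewrite [X in 0 <= X](_ : _ = K * (N * K - u * u^*)); last by ring.
by rewrite (pmulr_rge0 _ K0) subr_ge0 normCK.
Qed.

Lemma ip_phis n : ip mu (phis alpha n) (phis alpha n) = 1.
Proof.
rewrite (@ip_ext _ _ _ (phi alpha n)); first by rewrite ip_phi eqxx.
by move=> z z1; rewrite norm_phis_circle.
Qed.

(** At w, both phi_n^* and phi_{n+1} are compared with the kernel: the first is large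
    by the Christoffel-Darboux formula, the second is at most a multiple of |w - w'|,
    and the recursion relates the two because phi_n(w) = 0. *)
Lemma consecutive_zeros (U : set R[i]) (c : R[i]) n w w' :
    open U -> mu U = 0%E -> 0 < c ->
    (forall z, ~ U z -> c <= `|z - w|) -> (forall z, ~ U z -> c <= `|z - w'|) ->
    root (phi alpha n) w -> root (phi alpha n.+1) w' ->
  `|alpha n| * c ^+ 2 <= `|w - w'|.
Proof.
move=> oU U0 c0 Uw Uw' /rootP wn w'n.
have cge0 := ltW c0.
have K1 := kern_diag_ge1 alpha w (ltn0Sn n).
have K0 : 0 < kern alpha n.+1 w w := lt_le_trans ltr01 K1.
set K := kern alpha n.+1 w w in K1 K0.
have hK : c ^+ 2 * K <= `|(phis alpha n).[w]| ^+ 2.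
  rewrite /K -ip_kernp_kernp.
  have -> : `|(phis alpha n).[w]| ^+ 2 =
      ip mu (((phis alpha n).[w])^* *: phis alpha n)
        (((phis alpha n).[w])^* *: phis alpha n).
    by rewrite ipZl ipZr ip_phis mulr1 conjCK normCK.
  apply: (ip_lower_bound oU U0 cge0) => z z1 nUz.
  have -> : (((phis alpha n).[w])^* *: phis alpha n).[z] =
      (1 - z * w^*) * (kernp alpha n.+1 w).[z].
    by rewrite kernpE christoffel_darbouxS// wn rmorph0 !mulr0 subr0 hornerZ mulrC.
  rewrite normrM ler_wpM2r// (le_trans (Uw z nUz))//.
  rewrite le_eqVlt; apply/orP; left; apply/eqP.
  have zz : z * z^* = 1 by rewrite -normCK z1 expr1n.
  have -> : 1 - z * w^* = z * (z - w)^* by rewrite rmorphB/= mulrBr zz.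
  by rewrite normrM norm_conjC z1 mul1r.
have hphi : c ^+ 2 * `|(phi alpha n.+1).[w]| ^+ 2 <= `|w - w'| ^+ 2 * K.
  have /factor_theorem[q qE] := w'n.
  have sq : (size q <= n.+1)%N.
    have q0 : q != 0.
      apply: contraPneq (lead_phi alpha_lt1 n.+1) => q0.
      by rewrite qE q0 mul0r coef0 eqxx.
    have := size_phiE alpha_lt1 n.+1; rewrite qE size_Mmonic ?monicXsubC//.
    by rewrite size_XsubC addn2 /= => -[->].
  have hq : c ^+ 2 * ip mu q q <= 1.
    have -> : 1 = ip mu (phi alpha n.+1) (phi alpha n.+1) by rewrite ip_phi eqxx.
    apply: (ip_lower_bound oU U0 cge0) => z z1 nUz.
    by rewrite qE hornerM hornerXsubC normrM mulrC ler_wpM2l// Uw'.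
  rewrite qE hornerM hornerXsubC normrM exprMn mulrA mulrC ler_wpM2l ?exprn_ge0//.
  have := horner_le_kern w (ltn0Sn n) sq.
  move=> /(ler_wpM2l (exprn_ge0 2 cge0)) /le_trans; apply.
  by rewrite mulrA -[leRHS]mul1r ler_wpM2r// ltW.
have halpha : `|alpha n| ^+ 2 * `|(phis alpha n).[w]| ^+ 2 <=
    `|(phi alpha n.+1).[w]| ^+ 2.
  rewrite horner_phiS wn mulr0 sub0r mulrN normrN !normrM norm_conjC !exprMn.
  rewrite -[leLHS]mul1r ler_wpM2r ?mulr_ge0 ?exprn_ge0//.
  have r0 := rho_gt0 alpha_lt1 n.
  have r1 : rho alpha n <= 1.
    by rewrite -(@expr_le1 _ 2) ?(ltW r0)// sqr_rho -normCK gerBl exprn_ge0.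
  by rewrite gtr0_norm ?invr_gt0// exprVn invf_ge1 ?exprn_gt0// exprn_ile1// (ltW r0).
rewrite -(@ler_pXn2r _ 2)// ?nnegrE ?mulr_ge0 ?exprn_ge0// -(ler_pM2r K0).
apply: le_trans hphi; rewrite exprMn.
have -> : `|alpha n| ^+ 2 * (c ^+ 2) ^+ 2 * K =
  c ^+ 2 * (`|alpha n| ^+ 2 * (c ^+ 2 * K)) by ring.
rewrite ler_wpM2l ?exprn_ge0// (le_trans _ halpha)//.
by rewrite ler_wpM2l ?exprn_ge0.
Qed.

End Orthogonality.

(** * Zero-free discs with bounded zero sums *)

(** Each n given by the hypothesis has a_n >= a_0 / b, and the sum of the a_j below
    it is at most b.  As there are infinitely many such n, these sums are unbounded
    unless a_0 = 0. *)
Lemma first_term_eq0 (R : realType) (a : nat -> R) (b : R) :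
    (forall j, 0 <= a j) ->
    (forall N, exists n,
       [/\ (N <= n)%N, \sum_(j < n) a j <= b * a n & a n <= 1]) ->
  a 0%N = 0.
Proof.
move=> a0 H; apply/eqP; rewrite eq_le a0 andbT leNgt; apply/negP => m0.
pose s n := \sum_(j < n) a j.
have s_le k l : (k <= l)%N -> s k <= s l.
  move=> kl; rewrite -(subnKC kl); elim: (l - k)%N => [|i IHi]; first by rewrite addn0.
  by rewrite addnS /s big_ord_recr /= (le_trans IHi)// lerDl.
have s_gt n : (0 < n)%N -> a 0%N <= s n.
  by move=> n0; apply: le_trans (s_le _ _ n0); rewrite /s big_ord1.
have b0 : 0 < b.
  have [n [n1 hn an]] := H 1%N.
  have := lt_le_trans m0 (le_trans (s_gt n n1) hn).
  by apply: contraTT; rewrite -!leNgt => b0; rewrite mulr_le0_ge0.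
have s_ub n : s n <= b.
  have [n' [nn' hn' an']] := H n.
  rewrite (le_trans (s_le _ _ nn'))// (le_trans hn')//.
  by rewrite -[leRHS]mulr1 ler_wpM2l// ltW.
have grow k : exists n, k%:R * (a 0%N / b) <= s n.
  elim: k => [|k [n hn]]; first by exists 0%N; rewrite mul0r /s big_ord0.
  have [n' [nn' hn' _]] := H (maxn n 1).
  have {nn'} [nn' n'1] : (n <= n' /\ 1 <= n')%N by apply/andP; rewrite -geq_max.
  exists n'.+1; rewrite /s big_ord_recr/= -natr1 mulrDl mul1r lerD//.
    exact: le_trans (s_le _ _ nn').
  by rewrite ler_pdivrMr// mulrC (le_trans (s_gt _ n'1)).
have [n hn] := grow (Num.trunc (b ^+ 2 / a 0%N)).+1.
have := truncnS_gt (b ^+ 2 / a 0%N); rewrite ltNge => /negP; apply.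
rewrite ler_pdivlMr// expr2 -ler_pdivrMr// -mulrA.
exact: le_trans hn (s_ub n).
Qed.

Section CircleMeasure.
Context {R : realType}.

Lemma exists_argmin (T : eqType) (s : seq T) (f : T -> R) : s != [::] ->
  exists2 x, x \in s & forall y, y \in s -> f x <= f y.
Proof.
elim: s => // x [|x' s] IHs _.
  by exists x; rewrite ?mem_head// => y; rewrite inE => /eqP ->.
have [//|y ys hy] := IHs; have [xy|yx] := leP (f x) (f y).
  exists x; rewrite ?mem_head// => t; rewrite inE => /orP[/eqP ->//|/hy].
  exact: le_trans.
exists y; first by rewrite in_cons ys orbT.
move=> t; rewrite in_cons => /orP[/eqP ->|/hy//].
exact: ltW.
Qed.

Variable alpha : nat -> R[i].
Hypothesis alpha_lt1 : forall n, `|alpha n| < 1.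
Variable mu : probability (borelC R) R.
Hypothesis mu_alpha : is_verblunsky_measure alpha mu.
Implicit Types (w : R[i]).

Lemma off_circle_null (A : set (borelC R)) : measurable A ->
  A `&` @unit_circle R = set0 -> mu A = 0%E.
Proof.
move=> mA /disjoints_subset AS; apply/eqP; rewrite eq_le measure_ge0 andbT.
have mS := @measurable_circle R.
apply: (@le_trans _ _ (mu (~` @unit_circle R))).
  by apply: le_measure; rewrite ?inE//; exact: measurableC.
by rewrite probability_setC// mu_alpha.1 subee.
Qed.

(** A point off the circle is the centre of a disc disjoint from the circle. *)
Lemma supp_sub_circle z0 : supp mu z0 -> `|z0| = 1.
Proof.
move=> h; apply: contrapT => z01.
pose r := `|modc z0 - 1|.
have r0 : 0 < r.
  rewrite normr_gt0 subr_eq0; apply: contra_notN z01 => /eqP.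
  by rewrite modcE => ->.
have := h [set z : R[i] | `|z0 - z| < r%:C] (@open_ballC _ _ _).
rewrite /= subrr normr0 (ltcR 0 r) => /(_ r0).
rewrite off_circle_null ?ltxx//; first exact: open_measurableC (@open_ballC _ _ _).
apply/seteqP; split => // z [/= zr z1]; move: zr.
rewrite modcE ltcR /r ltNge => /negP; apply.
have mz : modc z = 1 by apply: complexI; rewrite -modcE z1.
have dist (x y : R[i]) : modc x - modc y <= modc (x - y).
  by rewrite lerBlDr -{1}[x](subrK y) le_modcD.
rewrite -mz ler_norml dist andbT lerNl opprB (le_trans (dist _ _))//.
by rewrite -lecR -!modcE distrC.
Qed.

Section Arc.
Variables (z0 : R[i]) (d : R).
Hypothesis d_gt0 : 0 < d.
Local Notation I := ([set z : borelC R | `|z0 - z| < d%:C] `&` @unit_circle R).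

Lemma measurable_arc : measurable I.
Proof.
apply: measurableI; last exact: measurable_circle.
exact: open_measurableC (@open_ballC _ _ _).
Qed.

Definition arc_mass j :=
  cintegral mu I (fun z => (phi alpha j).[z] * ((phi alpha j).[z])^*).

Lemma tame_normsq j : tame (fun z => (phi alpha j).[z] * ((phi alpha j).[z])^*).
Proof. by apply: tameM; [|apply: tame_conj]; exact: tame_horner. Qed.

Lemma tame_kern n : tame (fun z => kern alpha n z z).
Proof.
elim: n => [|n IHn].
  by under [fun=> _]funext do rewrite /kern big_ord0; exact: tame_cst.
by under [fun=> _]funext do rewrite kernS; apply: tameD => //; exact: tame_normsq.
Qed.

Lemma cintegral_kern n :
  cintegral mu I (fun z => kern alpha n z z) = \sum_(j < n) arc_mass j.
Proof.
elim: n => [|n IHn].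
  rewrite big_ord0; under eq_cintegral do rewrite /kern big_ord0.
  by rewrite cintegral_cst ?mul0r//; exact: measurable_arc.
rewrite big_ord_recr/= -IHn.
rewrite -(cintegralD mu measurable_arc (@subIsetr _ _ _) (tame_kern n) (tame_normsq n)).
by apply: eq_cintegral => z _; rewrite kernS.
Qed.

Lemma arc_mass_ge0 j : 0 <= arc_mass j.
Proof.
by apply: cintegral_ge0 => [|z _]; [exact: measurable_arc|exact: mul_conjC_ge0].
Qed.

Lemma arc_mass_le1 j : arc_mass j <= 1.
Proof.
have -> : 1 = ip mu (phi alpha j) (phi alpha j) by rewrite ip_phi// eqxx.
rewrite /ip (@eq_cintegral _ _ _ _
  (fun z => (phi alpha j).[z] * ((phi alpha j).[z])^*)); last first.
  by move=> z _; rewrite mulrC.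
apply: subset_le_cintegral => //; [exact: measurable_arc|exact: measurable_circle|
  exact: tame_normsq|by move=> z; exact: mul_conjC_ge0].
Qed.

(** The integral over the arc of [kern_diag_circle], with the zero sum replaced by
    its value at the centre. *)
Lemma arc_mass_sum n (c : R) :
    (forall w, w \in zeros alpha n -> 2 * d%:C <= `|z0 - w|) ->
    zsum (zeros alpha n) z0 <= c%:C ->
  \sum_(j < n) arc_mass j <= 4 * c%:C * arc_mass n.
Proof.
move=> hw hc; rewrite -cintegral_kern -(cintegralZ mu measurable_arc)//; last first.
  exact: tame_normsq.
apply: le_cintegral => [||||z [/= zd z1]];
  [exact: measurable_arc|by move=> z []|exact: tame_kern| |].
  by apply: tameM; [exact: tame_cst|exact: tame_normsq].
have zd' : `|z - z0| <= d%:C by rewrite distrC ltW.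
have zn := near_notin_zeros d_gt0 hw zd'.
have [hz _] := zsum_comparable alpha_lt1 d_gt0 hw zd'.
rewrite kern_diag_circle// -normCK mulrC ler_wpM2r ?exprn_ge0//.
by rewrite (le_trans hz)// ler_wpM2l.
Qed.

Lemma ball_null (c : R) :
    (forall N, exists n, [/\ (N <= n)%N,
      forall w, w \in zeros alpha n -> 2 * d%:C <= `|z0 - w| &
      zsum (zeros alpha n) z0 <= c%:C]) ->
  mu [set z : borelC R | `|z0 - z| < d%:C] = 0%E.
Proof.
move=> H; have mI := measurable_arc.
pose a j := Re (arc_mass j).
have aE j : arc_mass j = (a j)%:C.
  have := arc_mass_ge0 j; rewrite /a; case: (arc_mass j) => x y.
  by rewrite lecE => /andP[/eqP /= ->].
have a0 : a 0%N = 0.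
  apply: (@first_term_eq0 _ _ (4 * c)) => [j|N].
    by rewrite -lecR -aE arc_mass_ge0.
  have [n [Nn hw hc]] := H N; exists n; split => //.
    have := arc_mass_sum hw hc; rewrite aE.
    under eq_bigr do rewrite aE.
    by rewrite -rmorph_sum -(rmorph_nat (real_complex R)) -!rmorphM lecR.
  by rewrite -lecR -aE arc_mass_le1.
have I0 : mu I = 0%E.
  have := aE 0%N; rewrite a0 /arc_mass.
  rewrite (@eq_cintegral _ _ _ _ (fun=> 1)) ?cintegral_cst//; last first.
    by move=> z _; rewrite /= hornerC rmorph1 mulr1.
  rewrite mul1r => /complexI /eqP; rewrite fine_eq0 ?fin_num_measure// => /eqP.
  exact.
have mB := open_measurableC (@open_ballC R z0 d%:C).
have mS := @measurable_circle R.
have D0 : mu ([set z : borelC R | `|z0 - z| < d%:C] `\` @unit_circle R) = 0%E.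
  apply: off_circle_null; first exact: measurableD.
  by rewrite setDE -setIA setICl setI0.
rewrite (measureDI mu mB mS) -[RHS]adde0.
by congr (_ + _)%E.
Qed.

End Arc.
End CircleMeasure.

(** * The limit points of the zeros *)
Lemma exists_residue (p : nat) (P : nat -> Prop) : (0 < p)%N ->
    (forall N, exists n, (N <= n)%N /\ P n) ->
  exists j, forall N, exists n, [/\ (N <= n)%N, (n %% p)%N = j & P n].
Proof.
move=> p0 H; apply: contrapT => nj.
have {nj} /choice[b hb] j : exists N, forall n, (N <= n)%N -> (n %% p)%N = j -> ~ P n.
  apply: contrapT => nN; apply: nj; exists j => N; apply: contrapT => nn.
  by apply: nN; exists N => n Nn nj Pn; apply: nn; exists n.
have [n [Nn Pn]] := H (\sum_(j < p) b j)%N.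
have nj := ltn_pmod n p0.
apply: (hb _ n _ erefl Pn); apply: leq_trans Nn.
by rewrite (bigD1 (Ordinal nj))//= leq_addr.
Qed.

Section LimitPoints.
Context {R : realType}.
Variable alpha : nat -> R[i].
Hypothesis alpha_lt1 : forall n, `|alpha n| < 1.
Variable p : nat.
Hypothesis p_gt0 : (0 < p)%N.
Hypothesis alpha_periodic : forall n, alpha (n + p)%N = alpha n.
Hypothesis alpha_neq0 : exists n, alpha n != 0.
Variable mu : probability (borelC R) R.
Hypothesis mu_alpha : is_verblunsky_measure alpha mu.
Variable z0 : R[i].

(** Only indices n congruent to m modulo p are used, where alpha_m is nonzero: this
    is what bounds alpha_n from below in [consecutive_zeros]. *)
Lemma supp_of_limit (z : nat -> R[i]) :
    (forall n, (0 < n)%N -> root (phi alpha n) (z n)) ->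
    z n @[n --> \oo] --> z0 ->
  supp mu z0.
Proof.
move=> rz zz0 U oU Uz0; rewrite lt0e measure_ge0 andbT; apply/eqP => U0.
have /nbhs_ballP[e /= e0 eU] : nbhs z0 U by exact: open_nbhs_nbhs.
have [m am] := alpha_neq0.
pose c := e / 2; have c0 : 0 < c by rewrite divr_gt0.
(* Two points within dl of z0 are closer than consecutive_zeros allows. *)
pose dl := `|alpha m| * c ^+ 2 / 2.
have dl0 : 0 < dl by rewrite !mulr_gt0 ?exprn_gt0 ?normr_gt0.
have /cvgrPdist_lt hz := zz0.
have [N1 _ hN1] := hz _ c0; have [N2 _ hN2] := hz _ dl0.
pose n := (m + (N1 + N2).+1 * p)%N.
have nN : (N1 + N2 < n)%N by rewrite (leq_trans (leq_pmulr _ p_gt0))// leq_addl.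
have nN1 : (N1 <= n)%N by rewrite (leq_trans _ (ltnW nN))// leq_addr.
have nN2 : (N2 <= n)%N by rewrite (leq_trans _ (ltnW nN))// leq_addl.
have an : alpha n = alpha m.
  by rewrite -(alpha_modn alpha_periodic) /n addnC modnMDl (alpha_modn alpha_periodic).
have far k : (N1 <= k)%N -> forall w, ~ U w -> c <= `|w - z k|.
  move=> Nk w nUw; have zk := hN1 k Nk; rewrite /= in zk.
  have : ~ (`|z0 - w| < e) by move=> wz; apply: nUw; apply: eU; rewrite -ball_normE.
  rewrite modcE => h.
  have eR : e = (Re e)%:C.
    by move: e0; case: (e) => a b; rewrite ltcE/= => /andP[/eqP /= ->].
  have cR : c = (Re e / 2)%:C by rewrite rmorphM fmorphV rmorph_nat /c {1}eR.
  rewrite {}eR in h.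
  have h' : Re e <= modc (z0 - w) by rewrite leNgt -ltcR; apply/negP.
  move: zk; rewrite cR !modcE ltcR lecR => zk.
  have tri : modc (z0 - w) <= modc (z0 - z k) + modc (w - z k).
    by rewrite -lecR rmorphD; have := ler_distD (z k) z0 w; rewrite [`|z k - w|]distrC.
  lra.
have := consecutive_zeros alpha_lt1 mu_alpha oU U0 c0 (far n nN1)
  (far n.+1 (leqW nN1)) (rz n (leq_ltn_trans (leq0n _) nN)) (rz n.+1 (ltn0Sn n)).
rewrite an; apply/negP; rewrite -real_ltNge ?realE ?normr_ge0 ?mulr_ge0
  ?exprn_ge0 ?(ltW c0) ?(ltW e0)//.
have -> : `|alpha m| * c ^+ 2 = dl + dl by rewrite /dl -splitr.
apply: le_lt_trans (ler_distD z0 _ _) _.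
by rewrite ltrD// ?[`|z n - z0|]distrC; [exact: hN2|exact: (hN2 n.+1 (leqW nN2))].
Qed.

Lemma zsum_ge0 n w : 0 <= zsum (zeros alpha n) w.
Proof.
rewrite /zsum big_seq sumr_ge0// => v vn.
by apply: zsum_term_ge0; exact: (zeros_le1 alpha_lt1 vn).
Qed.

(** If no bound C on the zero sums works for infinitely many zero-free n, then the
    zero sums tend to infinity along all of them, hence along those in one residue
    class modulo p. *)
Lemma zeros_near_support (d : R) : supp mu z0 -> 0 < d <= 1 ->
  exists N, forall n, (N <= n)%N ->
    exists2 w, w \in zeros alpha n & `|z0 - w| < 2 * d%:C.
Proof.
move=> sz0 /andP[d0 d1]; apply: contrapT => nN.
have z01 := supp_sub_circle mu_alpha sz0.
pose far n := forall w, w \in zeros alpha n -> 2 * d%:C <= `|z0 - w|.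
have H N : exists n, (N <= n)%N /\ far n.
  apply: contrapT => nn; apply: nN; exists N => n Nn; apply: contrapT => nw.
  apply: nn; exists n; split=> // w wn.
  rewrite real_leNgt ?realE ?normr_ge0 ?mulr_ge0 ?ler0c ?(ltW d0)//.
  by apply/negP => zw; apply: nw; exists w.
have [[C hC]|nC] := pselect (exists C : R, forall N, exists n,
    [/\ (N <= n)%N, far n & zsum (zeros alpha n) z0 <= C%:C]).
  have := sz0 _ (@open_ballC R z0 d%:C).
  rewrite /= subrr normr0 (ltcR 0) => /(_ d0).
  by rewrite (ball_null alpha_lt1 mu_alpha d0 hC) ltxx.
have [j hj] := exists_residue p_gt0 H.
have [m /eqP] := alpha_neq0; apply.
apply: (alpha_eq0_of_concentration alpha_lt1 p_gt0 alpha_periodic z01 d0 d1 (j := j)).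
move=> N M; apply: contrapT => nn.
apply: nC; exists M => N'.
have [n [Nn nj fn]] := hj (maxn N N'); exists n.
move: Nn; rewrite geq_max => /andP[Nn N'n]; split=> //.
rewrite real_leNgt ?(ger0_real (zsum_ge0 _ _))//; last by apply/complex_realP; exists M.
apply/negP => /ltW Mz; apply: nn; exists n; split=> //.
Qed.

(** The sequence takes a zero of phi_n closest to z0, for each n. *)
Lemma limit_of_supp : supp mu z0 ->
  exists z : nat -> R[i],
    (forall n, (0 < n)%N -> root (phi alpha n) (z n)) /\
    z n @[n --> \oo] --> z0.
Proof.
move=> sz0.
have /choice[z hz] n : exists z, (0 < n)%N -> z \in zeros alpha n /\
    forall w, w \in zeros alpha n -> modc (z0 - z) <= modc (z0 - w).
  have [n0|n0] := posnP n; first by exists 0; rewrite n0.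
  have [|z zn hz] := @exists_argmin R _ (zeros alpha n) (fun w => modc (z0 - w)).
    by rewrite -size_eq0 (size_zeros alpha_lt1) -lt0n.
  by exists z => _; split.
exists z; split=> [n n0|]; first by rewrite (root_zeros alpha_lt1); have [] := hz n n0.
apply/cvgrPdist_lt => e e0.
have eR : e = (Re e)%:C.
  by move: e0; case: (e) => a b; rewrite ltcE/= => /andP[/eqP /= ->].
have e0' : 0 < Re e by rewrite -ltcR -eR.
pose d := Num.min (Re e / 2) 1.
have d01 : 0 < d <= 1 by rewrite /d lt_min ge_min divr_gt0// ltr01 lexx orbT.
have [N hN] := zeros_near_support sz0 d01.
exists N.+1 => // n /= Nn.
have n0 : (0 < n)%N by exact: leq_ltn_trans Nn.
have [w wn zw] := hN n (ltnW Nn).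
have [_ /(_ w wn) zmin] := hz n n0.
rewrite eR modcE ltcR (le_lt_trans zmin)//.
have d2 : 2 * d <= Re e.
  by rewrite mulrC -ler_pdivlMr// /d ge_min lexx.
by apply: lt_le_trans d2; rewrite -ltcR rmorphM rmorph_nat -modcE.
Qed.

End LimitPoints.

Unset Implicit Arguments.

Theorem theorem3p3 (R : realType) (alpha : nat -> R[i]) (p : nat)
    (alpha_lt1 : forall n, `|alpha n| < 1)
    (p_gt0 : (0 < p)%N)
    (alpha_periodic : forall n, alpha (n + p)%N = alpha n)
    (alpha_neq0 : exists n, alpha n != 0)
    (mu : probability (borelC R) R)
    (mu_alpha : is_verblunsky_measure alpha mu)
    (z0 : R[i]) :
  (exists z : nat -> R[i],
      (forall n, (0 < n)%N -> root (phi alpha n) (z n)) /\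
      z n @[n --> \oo] --> z0)
  <-> supp mu z0.
Proof.
split=> [[z [rz zz0]]|sz0].
  exact: (supp_of_limit alpha_lt1 p_gt0 alpha_periodic alpha_neq0 mu_alpha rz zz0).
exact: (limit_of_supp alpha_lt1 p_gt0 alpha_periodic alpha_neq0 mu_alpha sz0).
Qed.
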